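(* Let $\mu$ be a probability measure on $(\mathbb{R}^d, \mathcal{B}(\mathbb{R}^d))$ with full-dimensional support. Let $h: \mathbb{R}^d \to \mathbb{R}^d$ be a measurable function that is an isometry almost everywhere with respect to $\mu$. Then there exists a global Euclidean isometry $H: \mathbb{R}^d \to \mathbb{R}^d$ of the form $H(x) = Ax + b$, where $A$ is a real $d \times d$ matrix with $A^T A = I$ and $b \in \mathbb{R}^d$, such that $h(x) = H(x)$ for $\mu$-almost all $x \in \mathbb{R}^d$.
   Context: $\mathbb{R}^d$ is equipped with the standard inner product $\langle \cdot, \cdot \rangle$ and the Euclidean norm $\lVert \cdot \rVert$, and $\mathcal{B}(\mathbb{R}^d)$ denotes its Borel $\sigma$-algebra. Full-dimensional support: for a probability measure $\mu$ on $(\mathbb{R}^d, \mathcal{B}(\mathbb{R}^d))$, the support $\operatorname{supp}(\mu)$ is the set of all points $x \in \mathbb{R}^d$ for which every open neighborhood of $x$ has positive $\mu$-measure. The measure $\mu$ has full-dimensional support if $\operatorname{supp}(\mu)$ is not contained in any proper affine hyperplane of $\mathbb{R}^d$. Isometry almost everywhere: let $(Z, \mathcal{A}, \mu)$ be a probability space where $Z \subseteq \mathbb{R}^d$. A measurable map $h: Z \to \mathbb{R}^d$ is called an isometry almost everywhere (with respect to $\mu$) if there exists a set $D \in \mathcal{A} \otimes \mathcal{A}$ with $(\mu \times \mu)(D^c) = 0$ such that $\lVert h(z) - h(\tilde{z}) \rVert = \lVert z - \tilde{z} \rVert$ for all $(z, \tilde{z}) \in D$. Here this is applied with $Z = \mathbb{R}^d$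 and $\mathcal{A} = \mathcal{B}(\mathbb{R}^d)$. *)

(* Defs.v *)
From HB Require Import structures.
From mathcomp Require Import all_boot all_order all_algebra.
From mathcomp Require Import all_classical all_reals all_analysis.

Set Implicit Arguments.
Unset Strict Implicit.
Unset Printing Implicit Defensive.

Import Order.TTheory GRing.Theory Num.Theory.
Import numFieldNormedType.Exports.

Local Open Scope classical_set_scope.
Local Open Scope ring_scope.

(* Points of R^d are column vectors. The topology of 'cV[R]_d is the product
   topology, i.e. the usual one, so this is R^d with its Borel sigma-algebra. *)
Notation borel_cV R d := (g_sigma_algebraType (@open 'cV[R]_d)).

Definition dotv (R : realType) (d : nat) (x y : 'cV[R]_d) : R :=
  \sum_(i < d) x i ord0 * y i ord0.

(* The library norm `|x| on matrices is the sup norm, hence this definition. *)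
Definition enorm (R : realType) (d : nat) (x : 'cV[R]_d) : R :=
  Num.sqrt (dotv x x).

Definition msupp (R : realType) (d : nat)
    (mu : {measure set (borel_cV R d) -> \bar R}) : set 'cV[R]_d :=
  [set x | forall U : set 'cV[R]_d, open U -> U x -> (0 < mu U)%E].

Definition affine_hyperplane (R : realType) (d : nat) (P : set 'cV[R]_d) :=
  exists (a : 'cV[R]_d) (c : R), a != 0 /\ P = [set x | dotv a x = c].

Definition full_dim_support (R : realType) (d : nat)
    (mu : {measure set (borel_cV R d) -> \bar R}) : Prop :=
  ~ exists P : set 'cV[R]_d, affine_hyperplane P /\ msupp mu `<=` P.

Definition isometry_ae (R : realType) (d : nat)
    (mu : probability (borel_cV R d) R) (h : 'cV[R]_d -> 'cV[R]_d) : Prop :=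
  exists D : set (borel_cV R d * borel_cV R d),
    [/\ measurable D, (mu \x mu)%E (~` D) = 0%E &
        forall z z' : 'cV[R]_d, D (z, z') ->
          enorm (h z - h z') = enorm (z - z')].

Definition eisometry (R : realType) (d : nat) (H : 'cV[R]_d -> 'cV[R]_d) :=
  forall x y : 'cV[R]_d, enorm (H x - H y) = enorm (x - y).

(* Main.v *)
Require Import Defs.
From HB Require Import structures.
From mathcomp Require Import all_boot all_order all_algebra.
From mathcomp Require Import all_classical all_reals all_analysis.
From mathcomp Require Import ring.

Set Implicit Arguments.
Unset Strict Implicit.
Unset Printing Implicit Defensive.

Import Order.TTheory GRing.Theory Num.Theory.
Import numFieldNormedType.Exports.

Local Open Scope classical_set_scope.
Local Open Scope ring_scope.

(** By Fubini, almost every x satisfies |h x - h y| = |x - y| for almost every y.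
    No hyperplane has full measure, so d + 1 affinely independent points
    x_0, ..., x_d can be picked greedily, all of this kind and with h isometric
    on them: as long as the points chosen so far lie in a hyperplane, the next one
    is found outside it. By polarization, the Gram matrix of the vectors x_i - x_0
    is that of the h x_i - h x_0, so a single orthogonal matrix A sends the former
    to the latter. Almost every z is at the same distance from each x_i as h z
    from h x_i; by polarization again this determines h z - h x_0 = A (z - x_0). *)

Lemma dotv_ge0 (R : realType) (d : nat) (x : 'cV[R]_d) : 0 <= dotv x x.
Proof. by apply: sumr_ge0 => i _; rewrite -expr2 sqr_ge0. Qed.

Lemma dotvE (R : realType) (d : nat) (x y : 'cV[R]_d) :
  dotv x y = (x^T *m y) 0 0.
Proof. by rewrite mxE; apply: eq_bigr => i _; rewrite mxE. Qed.

Lemma dotv_polarization (R : realType) (d : nat) (x y : 'cV[R]_d) :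
  2 * dotv x y = dotv x x + dotv y y - dotv (x - y) (x - y).
Proof.
rewrite /dotv -big_split -sumrB mulr_sumr; apply: eq_bigr => i _ /=.
by rewrite !mxE; ring.
Qed.

Lemma enorm_eq_dotv (R : realType) (d : nat) (x y : 'cV[R]_d) :
  enorm x = enorm y <-> dotv x x = dotv y y.
Proof.
split=> [|e]; last by rewrite /enorm e.
by move/eqP; rewrite eqr_sqrt ?dotv_ge0// => /eqP.
Qed.

(** Since x - y = (x - z) - (y - z), polarization writes the inner product at the base point z
    through the three distances alone. *)
Lemma dotv_isometric (R : realType) (d : nat) (x y z x' y' z' : 'cV[R]_d) :
  enorm (x - z) = enorm (x' - z') -> enorm (y - z) = enorm (y' - z') ->
  enorm (x - y) = enorm (x' - y') ->
  dotv (x - z) (y - z) = dotv (x' - z') (y' - z').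
Proof.
move=> /enorm_eq_dotv exz /enorm_eq_dotv eyz /enorm_eq_dotv exy.
have /mulfI : (2 : R) != 0 by rewrite pnatr_eq0.
apply; rewrite !dotv_polarization exz eyz.
by rewrite !opprB (addrA (x - z)) (addrA (x' - z')) !subrK exy.
Qed.

Lemma enormB (R : realType) (d : nat) (x y : 'cV[R]_d) :
  enorm (x - y) = enorm (y - x).
Proof.
by apply/enorm_eq_dotv/eq_bigr => i _; rewrite !mxE; ring.
Qed.

Lemma dotv_continuous (R : realType) (d : nat) (a : 'cV[R]_d) :
  continuous (dotv a).
Proof.
apply: (@continuous_big _ _ +%R) => [|i _]; first exact: add_continuous.
by move=> x; apply: continuousM; [exact: cst_continuous|exact: coord_continuous].
Qed.

Lemma ae_xsection (dT : measure_display) (T : measurableType dT) (R : realType)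
    (mu : probability T R) (D : set (T * T)) :
  measurable D -> (mu \x mu)%E (~` D) = 0%E ->
  {ae mu, forall x, {ae mu, forall y, D (x, y)}}.
Proof.
move=> mD mu0.
have mDC := measurableC mD.
have : ae_eq mu setT (mu \o xsection (~` D)) (cst 0%E).
  apply/ae_eq_integral_abs => //; first exact: measurable_fun_xsection.
  rewrite -[RHS]mu0; apply: eq_integral => x _.
  by rewrite /= gee0_abs.
apply: filterS => x /(_ I) /= x0.
exists (xsection (~` D) x); split => //; first exact: measurable_xsection.
by move=> y /= nD; rewrite /xsection/= inE.
Qed.

Lemma ae_pick (dT : measure_display) (T : measurableType dT) (R : realType)
    (mu : {measure set T -> \bar R}) (P Q : T -> Prop) :
  {ae mu, forall x, Q x} -> ~ {ae mu, forall x, P x} -> exists x, Q x /\ ~ P x.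
Proof.
move=> aeQ naeP; apply: contrapT => nex; apply: naeP.
apply: filterS aeQ => x Qx; apply: contrapT => nPx.
by apply: nex; exists x.
Qed.

(** Otherwise the complement of the hyperplane would be open and null, so it would miss the support,
    which would then lie in the hyperplane. *)
Lemma hyperplane_not_ae (R : realType) (d : nat)
    (mu : probability (borel_cV R d) R) (a : 'cV[R]_d) (c : R) :
  full_dim_support mu -> a != 0 -> ~ {ae mu, forall x, dotv a x = c}.
Proof.
move=> full a0 aeP; apply: full; exists [set x | dotv a x = c]; split.
  by exists a, c.
have oP : open (~` [set x | dotv a x = c]).
  apply: closed_openC.
  apply: (@preimage_closed _ _ (dotv a) [set c]); last exact: closed_eq.
  by move=> x _; exact: dotv_continuous.
move=> x /(_ _ oP) sx; apply: contrapT => nPx.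
have mP : measurable (~` [set x | dotv a x = c] : set (borel_cV R d)).
  exact: sub_sigma_algebra.
have /negligibleP : mu.-negligible (~` [set x | dotv a x = c]) by [].
by move=> /(_ mP) mu0; have := sx nPx; rewrite mu0 ltxx.
Qed.

(** Multiplying a vanishing combination of the rows by [a] kills the rows of [X] and leaves the
    coefficient of [u] times a nonzero scalar. *)
Lemma row_free_col_mx (F : fieldType) (k d : nat) (X : 'M[F]_(k, d))
    (u : 'rV[F]_d) (a : 'cV[F]_d) :
  row_free X -> X *m a = 0 -> (u *m a) 0 0 != 0 -> row_free (col_mx X u).
Proof.
move=> freeX Xa ua; apply: inj_row_free => v.
rewrite -[v]hsubmxK mul_row_col => e.
have : rsubmx v *m (u *m a) = 0.
  by have := congr1 (mulmx^~ a) e; rewrite mulmxDl mul0mx -!mulmxA Xa mulmx0 add0r.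
rewrite [u *m a]mx11_scalar mul_mx_scalar => /eqP.
rewrite scaler_eq0 (negPf ua)/= => /eqP v2; move: e.
rewrite v2 mul0mx addr0 => e.
have -> : lsubmx v = 0 by apply: (row_free_inj freeX); rewrite e mul0mx.
by rewrite row_mx0.
Qed.

(** The rows of [X] are the differences x_i - x_0, so affine independence of the points becomes
    invertibility of [X]. *)
Lemma ex_frame (R : realType) (d : nat) (mu : probability (borel_cV R d) R)
    (E : 'cV[R]_d -> 'cV[R]_d -> Prop) :
  full_dim_support mu -> (forall x, E x x) -> (forall x y, E x y -> E y x) ->
  {ae mu, forall x, {ae mu, forall y, E x y}} ->
  exists (x0 : 'cV[R]_d) (X : 'M[R]_d),
    let pt i := (row i X)^T + x0 in
    [/\ X \in unitmx,
        {ae mu, forall y, E x0 y},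
        forall i, {ae mu, forall y, E (pt i) y},
        forall i, E x0 (pt i) &
        forall i j, E (pt i) (pt j)].
Proof.
move=> mu_full Erefl Esym aeE.
have PF : ProperFilter (almost_everywhere mu).
  have mu_gt0 : (0 < mu setT)%E by rewrite probability_setT.
  exact: ae_properfilter_algebraOfSetsType mu_gt0.
have [x0 aex0] := filter_ex aeE.
(* Induction on the number of points besides [x0]. Each of them has to be related to almost every
   point, so that the next can be chosen related to all of them. *)
suff H (k : nat) : (k <= d)%N -> exists X : 'M[R]_(k, d),
    let pt i := (row i X)^T + x0 in
    [/\ row_free X, forall i, {ae mu, forall y, E (pt i) y},
        forall i, E x0 (pt i) & forall i j, E (pt i) (pt j)].
  have [X [freeX aeX E0 EX]] := H d (leqnn d).
  by exists x0, X; split; rewrite // -row_free_unit.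
elim: k => [_|k IH kd].
  by exists 0; split; [apply: inj_row_free => v _; exact: thinmx0|case..].
have [X [freeX aeX E0 EX]] := IH (ltnW kd).
(* As k < d, some nonzero [a] is orthogonal to all rows of [X]. [kermx] is a left kernel, hence the
   transposes. *)
pose a := (nz_row (kermx X^T))^T.
have a0 : a != 0.
  rewrite -(inj_eq trmx_inj) trmxK trmx0 nz_row_eq0 kermx_eq0 -row_leq_rank.
  by rewrite mxrank_tr (eqP freeX) -ltnNge.
have Xa : X *m a = 0.
  apply: trmx_inj; rewrite trmx_mul trmxK trmx0.
  have /submxP[w ->] := nz_row_sub (kermx X^T).
  by rewrite -mulmxA mulmx_ker mulmx0.
have aeQ : {ae mu, forall z, [/\ E x0 z, forall i, E ((row i X)^T + x0) z &
                              {ae mu, forall y, E z y}]}.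
  have aeX' : {ae mu, forall z, forall i, E ((row i X)^T + x0) z}.
    exact: filter_forall.
  by apply: filterS3 aex0 aeX' aeE => z; split.
(* The hyperplane through [x0] with normal [a] contains all points chosen so far; [z] is taken off
   it. *)
have [z [[Ez0 EzX aez] nz]] :=
  ae_pick aeQ (hyperplane_not_ae (c := dotv a x0) mu_full a0).
suff [Y freeY ptY] : exists2 Y : 'M[R]_(k.+1, d), row_free Y &
    forall i, (row i Y)^T + x0 = z \/ exists j, (row i Y)^T + x0 = (row j X)^T + x0.
  exists Y; split => // [i|i|i j].
  - by case: (ptY i) => [->|[l ->]].
  - by case: (ptY i) => [->|[l ->]].
  - case: (ptY i) => [->|[l ->]]; case: (ptY j) => [->|[m ->]] //.
    exact: Esym.
rewrite -addn1; exists (col_mx X (z - x0)^T).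
  apply: (row_free_col_mx freeX Xa).
  apply: contra_notN nz => /eqP e; apply/eqP; rewrite -subr_eq0; apply/eqP.
  rewrite -[RHS]e -dotvE /dotv -sumrB; apply: eq_bigr => i _.
  by rewrite !mxE; ring.
move=> i; case: (split_ordP i) => j ->.
  by right; exists j; rewrite rowKu.
by left; rewrite rowKd row_id ?trmxK ?subrK// ord1.
Qed.

Lemma mulmx_dotv (R : realType) (d k : nat) (X : 'M[R]_(k, d)) (u : 'cV[R]_d) i :
  (X *m u) i 0 = dotv (row i X)^T u.
Proof. by rewrite mxE; apply: eq_bigr => j _; rewrite !mxE. Qed.

Lemma mulmx_tr_dotv (R : realType) (d k : nat) (X : 'M[R]_(k, d)) i j :
  (X *m X^T) i j = dotv (row i X)^T (row j X)^T.
Proof. by rewrite -mulmx_dotv !mxE; apply: eq_bigr => l _; rewrite !mxE. Qed.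

(** Equal Gram matrices make B = X^-1 Y orthogonal. As Y = X B, the equation Y v = X u says B v = u,
    so A = B^T works. *)
Lemma orthogonal_of_gram (F : fieldType) (d : nat) (X Y : 'M[F]_d) :
  X \in unitmx -> Y *m Y^T = X *m X^T ->
  exists A : 'M[F]_d, A^T *m A = 1%:M /\
    forall u v : 'cV[F]_d, Y *m v = X *m u -> v = A *m u.
Proof.
move=> unitX gram; pose B := invmx X *m Y.
have BB : B *m B^T = 1%:M.
  rewrite trmx_mul mulmxA -(mulmxA _ Y) gram mulmxA mulVmx // mul1mx.
  by rewrite -trmx_mul mulVmx // trmx1.
exists B^T; split=> [|u v e]; first by rewrite trmxK.
by rewrite -[u](mulKmx unitX) -e (mulmxA _ Y) mulmxA (mulmx1C BB) mul1mx.
Qed.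

Lemma eisometry_affine (R : realType) (d : nat) (A : 'M[R]_d) (b : 'cV[R]_d) :
  A^T *m A = 1%:M -> eisometry (fun x => A *m x + b).
Proof.
move=> AA x y; apply/enorm_eq_dotv.
rewrite opprD addrACA subrr addr0 -mulmxBr !dotvE trmx_mul.
by rewrite -mulmxA (mulmxA A^T) AA mul1mx.
Qed.

Theorem theorem4p1 (R : realType) (d : nat) (mu : probability (borel_cV R d) R)
    (h : borel_cV R d -> borel_cV R d)
    (mu_full : full_dim_support mu)
    (h_meas : measurable_fun [set: borel_cV R d] h)
    (h_iso : isometry_ae mu h) :
  exists (H : 'cV[R]_d -> 'cV[R]_d) (A : 'M[R]_d) (b : 'cV[R]_d),
    [/\ eisometry H,
        A^T *m A = 1%:M,
        forall x : 'cV[R]_d, H x = A *m x + b &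
        {ae mu, forall x, h x = H x}].
Proof.
move: h_iso => [D [mD D0 Dh]].
(* [g] is [h] read as a map of plain column vectors, whose values can be subtracted. *)
pose g : 'cV[R]_d -> 'cV[R]_d := h.
pose E (x y : 'cV[R]_d) := enorm (g x - g y) = enorm (x - y).
have aeE : {ae mu, forall x, {ae mu, forall y, E x y}}.
  by apply: filterS (ae_xsection mD D0) => x; apply: filterS => y; exact: Dh.
have Esym x y : E x y -> E y x.
  by move=> Exy; exact: etrans (enormB _ _) (etrans Exy (enormB _ _)).
have Erefl x : E x x by rewrite /E !subrr.
have [x0 [X [unitX ae0 aeX E0 EX]]] := ex_frame mu_full Erefl Esym aeE.
pose pt i := (row i X)^T + x0.
have ptE i : (row i X)^T = pt i - x0 by rewrite addrK.
pose Y : 'M[R]_d := \matrix_i (g (pt i) - g x0)^T.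
have YE i : (row i Y)^T = g (pt i) - g x0 by rewrite rowK trmxK.
have Edot x y : E x0 x -> E x0 y -> E x y ->
    dotv (g x - g x0) (g y - g x0) = dotv (x - x0) (y - x0).
  by move=> /Esym xx0 /Esym yx0 xy; exact: dotv_isometric.
have gram : Y *m Y^T = X *m X^T.
  by apply/matrixP => i j; rewrite !mulmx_tr_dotv !YE !ptE; exact: Edot (E0 i) (E0 j) (EX i j).
have [A [AA solveA]] := orthogonal_of_gram unitX gram.
(* The translation is the one for which [x0] goes to [g x0]. *)
exists (fun x => A *m x + (g x0 - A *m x0)), A, (g x0 - A *m x0).
split => //; first exact: eisometry_affine.
have aeX' : {ae mu, forall z, forall i, E (pt i) z} by exact: filter_forall.
have FF := ae_filter_ringOfSetsType mu.
apply: filterS2 ae0 aeX' => z E0z EXz.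
(* The entries of the two sides are the inner products with the frame vectors at [g x0] and at [x0],
   which [Edot] equates. *)
suff /solveA e : Y *m (g z - g x0) = X *m (z - x0).
  by rewrite addrCA -mulmxBr -e addrC subrK.
by apply/matrixP => i j; rewrite ord1 !mulmx_dotv YE ptE; exact: Edot (E0 i) E0z (EXz i).
Qed.
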